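(* Let $(M,J,g)$ be a non-Kähler Vaisman manifold (not necessarily compact). Then the metric $g$ is not flat.
   Context: All objects are smooth. A locally conformally Kähler manifold is a Hermitian manifold $(M,J,g)$ whose fundamental 2-form $\omega$ satisfies $d\omega=\theta\wedge\omega$ for some closed 1-form $\theta$ (the Lee form). It is a Vaisman manifold if moreover the Lee form is parallel, $\nabla\theta=0$, for the Levi-Civita connection $\nabla$ of $g$. Non-Kähler means that $(J,g)$ is not a Kähler structure, i.e. $\omega$ is not closed. Flat means that the Riemann curvature tensor vanishes identically. *)

(* Defs.v *)
From HB Require Import structures.
From mathcomp Require Import all_boot all_order all_algebra ring.
From mathcomp Require Import all_classical all_reals all_analysis.

Set Implicit Arguments.
Unset Strict Implicit.
Unset Printing Implicit Defensive.

Import Order.TTheory GRing.Theory Num.Theory.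
Import numFieldNormedType.Exports.

Local Open Scope classical_set_scope.
Local Open Scope ring_scope.

(* Smooth manifolds are given by an atlas with values in R^n = 'rV[R]_n, and  *)
(* tensor fields by their components in every chart, subject to the usual     *)
(* transformation law.  Component functions are total on 'rV[R]_n, but only   *)
(* their values on the (open) image of the chart are ever constrained.        *)
(* n is the real dimension, and manifolds need be neither connected nor       *)
(* compact.                                                                   *)

Section SmoothFunctions.
Context {R : realType} {n : nat}.

Definition partial (a : 'I_n) (f : 'rV[R]_n -> R) (x : 'rV[R]_n) : R :=
  'D_(delta_mx 0 a) f x.

Fixpoint Ck_on (k : nat) (U : set 'rV[R]_n) (f : 'rV[R]_n -> R) : Prop :=
  if k is k'.+1 then
    (forall x, U x -> differentiable f x) /\
    (forall a, Ck_on k' U (partial a f))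
  else forall x, U x -> {for x, continuous f}.

Definition smooth_on (U : set 'rV[R]_n) (f : 'rV[R]_n -> R) : Prop :=
  forall k, Ck_on k U f.

Definition smooth_mx_on p q (U : set 'rV[R]_n) (F : 'rV[R]_n -> 'M[R]_(p, q)) :
  Prop := forall a b, smooth_on U (fun x => F x a b).

End SmoothFunctions.

Record chart (R : realType) (n : nat) (M : topologicalType) := Chart {
  dom : set M;
  img : set 'rV[R]_n;
  coords : M -> 'rV[R]_n;
  param : 'rV[R]_n -> M;
  dom_open : open dom;
  img_open : open img;
  coords_img : forall p, dom p -> img (coords p);
  param_dom : forall x, img x -> dom (param x);
  coordsK : forall p, dom p -> param (coords p) = p;
  paramK : forall x, img x -> coords (param x) = x;
  coords_continuous : forall p, dom p -> {for p, continuous coords};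
  param_continuous : forall x, img x -> {for x, continuous param}
}.

Section Transition.
Context {R : realType} {n : nat} {M : topologicalType}.

Definition transition (c d : chart R n M) (x : 'rV[R]_n) : 'rV[R]_n :=
  coords d (param c x).

Definition overlap (c d : chart R n M) : set 'rV[R]_n :=
  [set x | img c x /\ dom d (param c x)].

End Transition.

Record manifold (R : realType) (n : nat) := Manifold {
  points :> topologicalType;
  points_hausdorff : hausdorff_space points;
  points_second_countable : @second_countable points;
  chart_index : Type;
  atlas : chart_index -> chart R n points;
  atlas_cover : forall p : points, exists i, dom (atlas i) p;
  atlas_smooth : forall i j,
    smooth_mx_on (overlap (atlas i) (atlas j)) (transition (atlas i) (atlas j))
}.

Section TensorFields.
Context {R : realType} {n : nat} (M : manifold R n).

(* MathComp-Analysis' Jacobian acts on row vectors on the right:              *)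
(* ('J f x) a b is the derivative of the b-th component of f along the a-th   *)
(* coordinate.                                                                *)

(* theta i x 0 a = theta(d_a) *)
Record one_form := OneForm {
  form_comp :> chart_index M -> 'rV[R]_n -> 'rV[R]_n;
  form_smooth : forall i, smooth_mx_on (img (atlas i)) (form_comp i);
  form_change : forall i j x, overlap (atlas i) (atlas j) x ->
    form_comp i x =
    form_comp j (transition (atlas i) (atlas j) x) *m ('J (transition (atlas i) (atlas j)) x)^T
}.

(* g i x a b = g(d_a, d_b) *)
Record bilinear_field := BilinearField {
  bilinear_comp :> chart_index M -> 'rV[R]_n -> 'M[R]_n;
  bilinear_smooth : forall i, smooth_mx_on (img (atlas i)) (bilinear_comp i);
  bilinear_change : forall i j x, overlap (atlas i) (atlas j) x ->
    bilinear_comp i x =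
    'J (transition (atlas i) (atlas j)) x *m bilinear_comp j (transition (atlas i) (atlas j) x)
      *m ('J (transition (atlas i) (atlas j)) x)^T
}.

(* J d_a = \sum_b J i x a b d_b, i.e. J acts on the row vector of components  *)
(* of a tangent vector by right multiplication                                *)
Record endo_field := EndoField {
  endo_comp :> chart_index M -> 'rV[R]_n -> 'M[R]_n;
  endo_smooth : forall i, smooth_mx_on (img (atlas i)) (endo_comp i);
  endo_change : forall i j x, overlap (atlas i) (atlas j) x ->
    endo_comp i x *m 'J (transition (atlas i) (atlas j)) x =
    'J (transition (atlas i) (atlas j)) x *m endo_comp j (transition (atlas i) (atlas j) x)
}.

End TensorFields.

Section LocalFormulas.
Context {R : realType} {n : nat}.
Implicit Types (x : 'rV[R]_n) (a b c d : 'I_n).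

(* c-th component of
   [J d_a, J d_b] - J [J d_a, d_b] - J [d_a, J d_b] - [d_a, d_b] *)
Definition nijenhuis (J : 'rV[R]_n -> 'M[R]_n) a b c x : R :=
  \sum_d (J x a d * partial d (fun y => J y b c) x
        - J x b d * partial d (fun y => J y a c) x
        + J x d c * partial b (fun y => J y a d) x
        - J x d c * partial a (fun y => J y b d) x).

Definition ext_der1 (theta : 'rV[R]_n -> 'rV[R]_n) a b x : R :=
  partial a (fun y => theta y 0 b) x - partial b (fun y => theta y 0 a) x.

Definition ext_der2 (omega : 'rV[R]_n -> 'M[R]_n) a b c x : R :=
  partial a (fun y => omega y b c) x + partial b (fun y => omega y c a) x
  + partial c (fun y => omega y a b) x.

Definition wedge12 (theta : 'rV[R]_n) (omega : 'M[R]_n) a b c : R :=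
  theta 0 a * omega b c + theta 0 b * omega c a + theta 0 c * omega a b.

(* christoffel g a b c is the symbol Gamma^c_{ab} of the Levi-Civita          *)
(* connection: nabla_{d_a} d_b = \sum_c Gamma^c_{ab} d_c                      *)
Definition christoffel (g : 'rV[R]_n -> 'M[R]_n) a b c x : R :=
  2^-1 * \sum_d invmx (g x) c d *
    (partial a (fun y => g y b d) x + partial b (fun y => g y a d) x
     - partial d (fun y => g y a b) x).

(* (nabla_{d_a} theta)(d_b) *)
Definition cov_der (g : 'rV[R]_n -> 'M[R]_n) (theta : 'rV[R]_n -> 'rV[R]_n)
    a b x : R :=
  partial a (fun y => theta y 0 b) x
  - \sum_c christoffel g a b c x * theta x 0 c.

(* d-th component of R(d_a, d_b) d_c,
   where R(X, Y) = [nabla_X, nabla_Y] - nabla_[X, Y] *)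
Definition riemann (g : 'rV[R]_n -> 'M[R]_n) a b c d x : R :=
  partial a (christoffel g b c d) x - partial b (christoffel g a c d) x
  + \sum_e (christoffel g b c e x * christoffel g a e d x
          - christoffel g a c e x * christoffel g b e d x).

End LocalFormulas.

Section Geometry.
Context {R : realType} {n : nat} (M : manifold R n).
Implicit Types (J : endo_field M) (g : bilinear_field M) (theta : one_form M).

Definition riemannian g : Prop := forall i x, img (atlas i) x ->
  (g i x)^T = g i x /\
  forall v : 'rV[R]_n, v != 0 -> 0 < (v *m g i x *m v^T) 0 0.

Definition flat g : Prop :=
  forall i x, img (atlas i) x -> forall a b c d, riemann (g i) a b c d x = 0.

Definition complex_structure J : Prop := forall i x, img (atlas i) x ->
  J i x *m J i x = - 1%:M /\ forall a b c, nijenhuis (J i) a b c x = 0.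

Definition hermitian J g : Prop :=
  [/\ complex_structure J, riemannian g &
      forall i x, img (atlas i) x -> J i x *m g i x *m (J i x)^T = g i x].

(* omega(X, Y) = g(J X, Y); d and the wedge product above are normalised so   *)
(* that no numerical factor appears in d omega = theta /\ omega.              *)
Definition fund_form J g (i : chart_index M) (x : 'rV[R]_n) : 'M[R]_n :=
  J i x *m g i x.

Definition fund_form_closed J g : Prop :=
  forall i x, img (atlas i) x -> forall a b c, ext_der2 (fund_form J g i) a b c x = 0.

Definition kahler J g : Prop := hermitian J g /\ fund_form_closed J g.

Definition closed_form theta : Prop :=
  forall i x, img (atlas i) x -> forall a b, ext_der1 (theta i) a b x = 0.

Definition parallel g theta : Prop :=
  forall i x, img (atlas i) x -> forall a b, cov_der (g i) (theta i) a b x = 0.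

Definition lee_form J g theta : Prop :=
  closed_form theta /\
  forall i x, img (atlas i) x -> forall a b c,
    ext_der2 (fund_form J g i) a b c x =
    wedge12 (theta i x) (fund_form J g i x) a b c.

Definition lck J g : Prop :=
  hermitian J g /\ exists theta, lee_form J g theta.

Definition vaisman J g : Prop :=
  hermitian J g /\ exists theta, lee_form J g theta /\ parallel g theta.

Lemma vaisman_lck J g : vaisman J g -> lck J g.
Proof. by move=> [hJg [theta [? _]]]; split=> //; exists theta. Qed.

(* The Christoffel symbols are those of the unique torsion-free metric        *)
(* connection.                                                                *)

Lemma riemannian_unit g i x : riemannian g -> img (atlas i) x -> g i x \in unitmx.
Proof.
move=> hg /hg[_ gpos]; rewrite unitmxE unitfE; apply/det0P => -[v v0 vg].
by have := gpos _ v0; rewrite vg mul0mx mxE ltxx.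
Qed.

Lemma partial_sym g i x a b c : riemannian g -> img (atlas i) x ->
  partial a (fun y => g i y b c) x = partial a (fun y => g i y c b) x.
Proof.
move=> hg ix; apply: near_eq_derive.
have : nbhs x (img (atlas i)) by apply: open_nbhs_nbhs; split=> //; exact: img_open.
apply: filterS => y /hg[+ _].
by move/matrixP => /(_ c b); rewrite mxE.
Qed.

Lemma christoffel_torsion_free g i x a b c : riemannian g -> img (atlas i) x ->
  christoffel (g i) a b c x = christoffel (g i) b a c x.
Proof.
move=> hg ix; rewrite /christoffel; congr (_ * _); apply: eq_bigr => d _.
rewrite (partial_sym d a b hg ix); congr (_ * (_ - _)).
exact: addrC.
Qed.

Let christoffel_lower g i x a b c : riemannian g -> img (atlas i) x ->
  \sum_d christoffel (g i) a b d x * g i x d c =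
  2^-1 * (partial a (fun y => g i y b c) x + partial b (fun y => g i y a c) x
          - partial c (fun y => g i y a b) x).
Proof.
move=> hg ix; have gu := riemannian_unit hg ix.
pose F d := partial a (fun y => g i y b d) x + partial b (fun y => g i y a d) x
            - partial d (fun y => g i y a b) x.
transitivity (2^-1 * ((\row_d F d) *m (invmx (g i x))^T *m g i x) 0 c).
  rewrite mxE mulr_sumr; apply: eq_bigr => d _.
  rewrite /christoffel mxE -mulrA; congr (_ * (_ * _)).
  by apply: eq_bigr => e _; rewrite !mxE mulrC.
by rewrite trmx_inv (hg _ _ ix).1 mulmxKV // mxE.
Qed.

Lemma christoffel_metric g i x a b c : riemannian g -> img (atlas i) x ->
  partial a (fun y => g i y b c) x =
  \sum_d christoffel (g i) a b d x * g i x d c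
  + \sum_d christoffel (g i) a c d x * g i x b d.
Proof.
move=> hg ix.
have -> : \sum_d christoffel (g i) a c d x * g i x b d =
          \sum_d christoffel (g i) a c d x * g i x d b.
  by apply: eq_bigr => d _; rewrite -[in LHS](hg _ _ ix).1 mxE.
rewrite !christoffel_lower // (partial_sym a c b hg ix).
by field.
Qed.

Lemma christoffel_unique g i x (Gamma : 'I_n -> 'I_n -> 'I_n -> R) :
    riemannian g -> img (atlas i) x ->
    (forall a b c, Gamma a b c = Gamma b a c) ->
    (forall a b c, partial a (fun y => g i y b c) x =
      \sum_d Gamma a b d * g i x d c + \sum_d Gamma a c d * g i x b d) ->
  forall a b c, Gamma a b c = christoffel (g i) a b c x.
Proof.
move=> hg ix Gsym Gmet a b c; have gu := riemannian_unit hg ix.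
pose L a b c := \sum_d Gamma a b d * g i x d c.
have Lsym a' b' c' : L a' b' c' = L b' a' c'.
  by apply: eq_bigr => d _; rewrite Gsym.
have Lmet a' b' c' : partial a' (fun y => g i y b' c') x = L a' b' c' + L a' c' b'.
  rewrite Gmet; congr (_ + _); apply: eq_bigr => d _.
  by rewrite -[in LHS](hg _ _ ix).1 mxE.
suff: (\row_d Gamma a b d) *m g i x = (\row_d christoffel (g i) a b d x) *m g i x.
  by move/(can_inj (mulmxK gu))/rowP => /(_ c); rewrite !mxE.
apply/rowP => e; rewrite !mxE.
under eq_bigr do rewrite mxE.
under [RHS]eq_bigr do rewrite mxE.
rewrite christoffel_lower // !Lmet -/(L a b e).
rewrite (Lsym b a e) (Lsym e a b) (Lsym e b a).
by field.
Qed.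

End Geometry.

(* Main.v *)
(** Write theta for the Lee form, omega for the fundamental form, t = |theta|^2
    and eta = theta o J.  Integrability of J together with d omega = theta /\
    omega determines nabla J, and since theta is parallel this gives
    2 nabla eta = t omega + theta /\ eta =: P, a skew tensor (so eta is dual to
    a Killing field).  If g is flat, nabla_a P_bc is symmetric in a, b by the
    Ricci identity and skew in b, c, hence vanishes.  Expanding nabla P = 0 and
    contracting with J theta^# gives t g = theta (x) theta + eta (x) eta when
    t <> 0; then omega is proportional to eta /\ theta and theta /\ omega = 0.
    When t = 0, theta = 0.  So at every point d omega = 0. *)

Require Import Defs.
From mathcomp Require Import all_boot all_order all_algebra.
From mathcomp Require Import all_classical all_reals all_analysis.
From mathcomp Require Import ring lra.

Set Implicit Arguments.
Unset Strict Implicit.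
Unset Printing Implicit Defensive.

Import Order.TTheory GRing.Theory Num.Theory.
Import numFieldNormedType.Exports.

Local Open Scope classical_set_scope.
Local Open Scope ring_scope.

(** * Symmetry of second derivatives *)

(** The affine approximation of [f] at [x] also approximates [g] to first order, and a continuous
    linear part of such an approximation is unique. *)
Lemma near_eq_differentiable (R : numFieldType) (V W : normedModType R)
    (f g : V -> W) (x : V) :
  (\near x, f x = g x) -> differentiable f x -> differentiable g x.
Proof.
move=> fg dfx.
have e : g \o shift x = cst (g x) + 'd f x +o_ 0 id.
  apply/eqaddoP => _/posnumP[eps].
  have /eqaddoP /(_ eps%:num) := diff_locally dfx.
  have h0 : \forall y \near 0, f (y + x) = g (y + x).
    by move: fg; rewrite (near_shift 0 x) /=; apply: filterS => y /=; rewrite subr0.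
  move=> /(_ _) - H; near=> y.
  have -> : (g \o shift x - (cst (g x) + 'd f x)) y = (f \o shift x - (cst (f x) + 'd f x)) y.
    rewrite /= !fctE /= (nbhs_singleton fg); congr (_ - _).
    by rewrite (near h0 y).
  near: y; exact: H.
have dgx := diff_unique (diff_continuous dfx) e.
apply/diff_locallyP; split; first by rewrite dgx; exact: diff_continuous.
by rewrite dgx.
Unshelve. all: by end_near. Qed.

Section Young.
Context {R : realType} {V : normedModType R}.
Implicit Types (f p q : V -> R) (x u v : V).

(** Both difference quotients are the same function of the increment. This makes directional
    derivatives accessible to the one-variable mean value theorem. *)
Lemma is_derive_line f x u (s df : R) :
  is_derive (s *: u + x) u f df -> is_derive s (1 : R) (fun r => f (r *: u + x)) df.
Proof.
move=> [fd <-].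
have E : (fun h : R => h^-1 *: (((fun r => f (r *: u + x)) \o shift s) (h *: 1) - f (s *: u + x)))
   = (fun h => h^-1 *: ((f \o shift (s *: u + x)) (h *: u) - f (s *: u + x))).
  by apply/funext => h /=; rewrite [h%:A]mulr1 scalerDl addrA.
by split; [rewrite /derivable E | rewrite /derive E].
Qed.

(* The mean value theorem for [s |-> f (x + s u + h v) - f (x + s u)] turns the
   second difference into an increment of [p] in the direction [v]. *)
Lemma second_difference f p x u v :
  (\near x, is_derive x u f (p x)) -> differentiable p x ->
  (h ^+ 2)^-1 * (f (h *: u + h *: v + x) - f (h *: u + x)
                 - f (h *: v + x) + f x) @[h --> 0^'+] --> 'd p x v.
Proof.
move=> fp px; apply/cvgrPdist_le => e e0.
(* For [0 <= s <= h] the norms of [s *: u] and [s *: u + h *: v] add up to at most [h * K]; the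
   summand 1 keeps [K] positive when [u] and [v] vanish. *)
pose K := `|u| *+ 2 + `|v| + 1.
have K0 : 0 < K by rewrite ltr_wpDl // addr_ge0 // mulrn_wge0.
have eK0 : 0 < e / K by rewrite divr_gt0.
have /eqaddoP /(_ _ eK0) pd := diff_locally px.
have fp0 : \forall y \near 0, is_derive (y + x) u f (p (y + x)).
  by move: fp; rewrite (near_shift 0 x) /=; apply: filterS => y /=; rewrite subr0.
have /nbhs_ballP[d /= d0 dP] : \forall y \near 0, is_derive (y + x) u f (p (y + x)) /\
    `|p (y + x) - (p x + 'd p x y)| <= e / K * `|y|.
  by near=> y; split; [near: y; exact: fp0 | near: y; exact: pd].
have {}dP y : `|y| < d -> is_derive (y + x) u f (p (y + x)) /\
    `|p (y + x) - (p x + 'd p x y)| <= e / K * `|y|.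
  by move=> yd; apply: dP; rewrite -ball_normE /= sub0r normrN.
near=> h.
have h0 : 0 < h by near: h; exact: nbhs_right_gt.
have hd : h * K < d.
  by rewrite -ltr_pdivlMr //; near: h; apply: nbhs_right_lt; rewrite divr_gt0.
have small s : 0 <= s <= h -> `|s *: u| < d /\ `|s *: u + h *: v| < d.
  move=> /andP[s0 sh].
  have su : `|s *: u| <= h * `|u| by rewrite normrZ ger0_norm // ler_wpM2r.
  have hv : `|h *: v| = h * `|v| by rewrite normrZ gtr0_norm.
  have suv := ler_normD (s *: u) (h *: v).
  have hu0 : 0 <= h * `|u| by rewrite mulr_ge0 // ltW.
  have hv0 : 0 <= h * `|v| by rewrite mulr_ge0 // ltW.
  have hK : h * K = h * `|u| *+ 2 + h * `|v| + h by rewrite /K; ring.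
  by split; lra.
pose psi s := f (s *: u + (h *: v + x)) - f (s *: u + x).
have dpsi s : 0 <= s <= h ->
    is_derive s (1 : R) psi (p (s *: u + h *: v + x) - p (s *: u + x)).
  move=> /small[s1 s2]; apply: is_deriveB; apply: is_derive_line.
    by rewrite addrA; exact: (dP _ s2).1.
  exact: (dP _ s1).1.
have [c] : exists2 c, c \in `]0, h[%R &
    psi h - psi 0 = (p (c *: u + h *: v + x) - p (c *: u + x)) * (h - 0).
  apply: (@MVT R psi (fun s => p (s *: u + h *: v + x) - p (s *: u + x))) => //.
    by move=> s; rewrite in_itv /= => /andP[s0 sh]; apply: dpsi; rewrite !ltW.
  apply: derivable_within_continuous => s; rewrite in_itv /= => sh.
  by have [] := dpsi _ sh.
rewrite in_itv /= => /andP[c0 cLh] E.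
have ch' : 0 <= c <= h by rewrite !ltW.
have [c1 c2] := small _ ch'.
have := (dP _ c2).2; have {c1 c2} := (dP _ c1).2.
have -> : 'd p x (c *: u + h *: v) = c *: 'd p x u + h *: 'd p x v.
  by rewrite linearD !linearZ.
have -> : 'd p x (c *: u) = c *: 'd p x u by rewrite linearZ.
move: E; rewrite /psi !scale0r !add0r subr0 addrA.
set P1 := p (_ + x); set P2 := p (_ + x); set L := 'd p x v.
set Lu := 'd p x u => E P2e P1e.
have -> : (h ^+ 2)^-1 * (f (h *: u + h *: v + x) - f (h *: u + x) - f (h *: v + x) + f x)
    = (P1 - P2) / h.
  have -> : f (h *: u + h *: v + x) - f (h *: u + x) - f (h *: v + x) + f x = (P1 - P2) * h.
    by rewrite -E; ring.
  by field; rewrite gt_eqF.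
have -> : L - (P1 - P2) / h = h^-1 * (h * L - (P1 - P2)) by field; rewrite gt_eqF.
rewrite normrM normfV (gtr0_norm h0). rewrite ler_pdivrMl //.
have su : `|c *: u| <= h * `|u| by rewrite normrZ gtr0_norm // ler_wpM2r // ltW.
have hv : `|h *: v| = h * `|v| by rewrite normrZ gtr0_norm.
have suv := ler_normD (c *: u) (h *: v).
(* The unknown [c *: Lu] occurs in both linear approximations and cancels, so only the two
   remainders of [p] are left to bound. *)
have -> : h * L - (P1 - P2) = (P2 - (p x + c *: Lu)) - (P1 - (p x + (c *: Lu + h *: L))).
  by rewrite /GRing.scale /=; ring.
apply: (le_trans (ler_normB _ _)).
have : e / K * (`|c *: u| + `|c *: u + h *: v|) <= e / K * (h * K).
  rewrite ler_pM2l // /K.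
  have -> : h * (`|u| *+ 2 + `|v| + 1) = h * `|u| *+ 2 + h * `|v| + h by ring.
  lra.
have -> : e / K * (h * K) = h * e by field; rewrite gt_eqF.
move: P1e P2e; rewrite mulrDr; lra.
Unshelve. all: by end_near. Qed.

(** The second difference is unchanged when [u] and [v] are exchanged, so its quotient by [h ^+ 2]
    converges to both mixed derivatives. *)
Lemma derive_symmetric f p q x u v :
  (\near x, is_derive x u f (p x)) -> (\near x, is_derive x v f (q x)) ->
  differentiable p x -> differentiable q x -> 'D_v p x = 'D_u q x.
Proof.
move=> fp fq px qx; rewrite !deriveE //.
have := second_difference fp px (v := v).
under eq_fun => h do rewrite (addrC (h *: u)) [X in X + f x]addrAC.
by move=> /norm_cvg_unique; apply; exact: second_difference.
Qed.
End Young.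

(** * Entrywise calculus of matrix-valued functions *)

Section MatrixCalculus.
Context {R : realType} {n : nat}.
Implicit Types (x : 'rV[R]_n) (a : 'I_n).

(** Entrywise, to match [smooth_mx_on] and the component functions on which [partial] acts. *)
Definition mxdiff p q (F : 'rV[R]_n -> 'M[R]_(p, q)) x : Prop :=
  forall i j, differentiable (fun y => F y i j) x.

Definition mxpartial p q a (F : 'rV[R]_n -> 'M[R]_(p, q)) x : 'M[R]_(p, q) :=
  \matrix_(i, j) partial a (fun y => F y i j) x.

Lemma is_derive_partial (f : 'rV[R]_n -> R) a x : differentiable f x ->
  is_derive x (delta_mx 0 a) f (partial a f x).
Proof. by move=> fx; apply/derivableP/diff_derivable. Qed.

Lemma differentiable_sumf (I : finType) (P : pred I) (f : I -> 'rV[R]_n -> R) x :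
  (forall i, P i -> differentiable (f i) x) ->
  differentiable (fun y => \sum_(i | P i) f i y) x.
Proof.
move=> fx; rewrite -fct_sumE; elim/big_ind : _ => //.
by move=> g h; exact: differentiableD.
Qed.

Lemma differentiable_prodf (I : finType) (f : I -> 'rV[R]_n -> R) x :
  (forall i, differentiable (f i) x) ->
  differentiable (fun y => \prod_i f i y) x.
Proof.
move=> fx; rewrite -fct_prodE; elim/big_ind : _ => //.
by move=> g h; exact: differentiableM.
Qed.

Lemma mxdiffD p q (F H : 'rV[R]_n -> 'M[R]_(p, q)) x :
  mxdiff F x -> mxdiff H x -> mxdiff (fun y => F y + H y) x.
Proof.
move=> Fx Hx i j; under eq_fun => y do rewrite mxE.
exact: differentiableD.
Qed.

Lemma mxdiffN p q (F : 'rV[R]_n -> 'M[R]_(p, q)) x :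
  mxdiff F x -> mxdiff (fun y => - F y) x.
Proof.
move=> Fx i j; under eq_fun => y do rewrite mxE.
exact: differentiableN.
Qed.

Lemma mxdiff_tr p q (F : 'rV[R]_n -> 'M[R]_(p, q)) x :
  mxdiff F x -> mxdiff (fun y => (F y)^T) x.
Proof. by move=> Fx i j; under eq_fun => y do rewrite mxE. Qed.

Lemma mxdiffZ p q (f : 'rV[R]_n -> R) (F : 'rV[R]_n -> 'M[R]_(p, q)) x :
  differentiable f x -> mxdiff F x -> mxdiff (fun y => f y *: F y) x.
Proof.
move=> fx Fx i j; under eq_fun => y do rewrite mxE.
exact: differentiableM.
Qed.

Lemma mxdiffM p q r (F : 'rV[R]_n -> 'M[R]_(p, q))
    (H : 'rV[R]_n -> 'M[R]_(q, r)) x :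
  mxdiff F x -> mxdiff H x -> mxdiff (fun y => F y *m H y) x.
Proof.
move=> Fx Hx i j; under eq_fun => y do rewrite mxE.
by apply: differentiable_sumf => k _; exact: differentiableM.
Qed.

Lemma differentiable_det p (F : 'rV[R]_n -> 'M[R]_p) x :
  mxdiff F x -> differentiable (fun y => \det (F y)) x.
Proof.
move=> Fx; rewrite /determinant; apply: differentiable_sumf => s _.
apply: differentiableM => //.
exact: differentiable_prodf.
Qed.

Lemma near_eq_mxdiff p q (F H : 'rV[R]_n -> 'M[R]_(p, q)) x :
  (\near x, F x = H x) -> mxdiff F x -> mxdiff H x.
Proof.
move=> FH Fx i j; apply: near_eq_differentiable (Fx i j).
by apply: filterS FH => y ->.
Qed.

(** Near [x] the inverse is the adjugate divided by the determinant. At a singular matrix [invmx]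
    returns its argument, hence the hypothesis on a neighbourhood. *)
Lemma mxdiff_inv p (F : 'rV[R]_n -> 'M[R]_p) x :
  (\near x, F x \in unitmx) -> mxdiff F x -> mxdiff (fun y => invmx (F y)) x.
Proof.
move=> Fu Fx; apply: (@near_eq_mxdiff _ _ (fun y => (\det (F y))^-1 *: \adj (F y))).
  by apply: filterS Fu => y; rewrite /invmx => ->.
apply: mxdiffZ.
  apply: differentiableV; first exact: differentiable_det.
  by have := nbhs_singleton Fu; rewrite /= unitmxE unitfE.
move=> i j; under eq_fun => y do rewrite mxE /cofactor.
apply: differentiableM => //; apply: differentiable_det => k l.
by under eq_fun => y do rewrite !mxE.
Qed.

Lemma mxpartialD p q a (F H : 'rV[R]_n -> 'M[R]_(p, q)) x :
  mxdiff F x -> mxdiff H x ->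
  mxpartial a (fun y => F y + H y) x = mxpartial a F x + mxpartial a H x.
Proof.
move=> Fx Hx; apply/matrixP => i j; rewrite !mxE /partial.
under eq_fun => y do rewrite mxE.
by rewrite deriveD //; exact: diff_derivable.
Qed.

Lemma mxpartialN p q a (F : 'rV[R]_n -> 'M[R]_(p, q)) x :
  mxdiff F x -> mxpartial a (fun y => - F y) x = - mxpartial a F x.
Proof.
move=> Fx; apply/matrixP => i j; rewrite !mxE /partial.
under eq_fun => y do rewrite mxE.
by rewrite deriveN //; exact: diff_derivable.
Qed.

Lemma mxpartial_tr p q a (F : 'rV[R]_n -> 'M[R]_(p, q)) x :
  mxpartial a (fun y => (F y)^T) x = (mxpartial a F x)^T.
Proof.
by apply/matrixP => i j; rewrite !mxE; under eq_fun => y do rewrite mxE.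
Qed.

Lemma mxpartialZ p q a (f : 'rV[R]_n -> R) (F : 'rV[R]_n -> 'M[R]_(p, q)) x :
  differentiable f x -> mxdiff F x ->
  mxpartial a (fun y => f y *: F y) x =
  partial a f x *: F x + f x *: mxpartial a F x.
Proof.
move=> fx Fx; apply/matrixP => i j; rewrite !mxE /partial.
under eq_fun => y do rewrite mxE.
rewrite deriveM; [|exact: diff_derivable..].
by rewrite addrC /GRing.scale /=; congr (_ + _); exact: mulrC.
Qed.

Lemma mxpartialM p q r a (F : 'rV[R]_n -> 'M[R]_(p, q))
    (H : 'rV[R]_n -> 'M[R]_(q, r)) x :
  mxdiff F x -> mxdiff H x ->
  mxpartial a (fun y => F y *m H y) x =
  mxpartial a F x *m H x + F x *m mxpartial a H x.
Proof.
move=> Fx Hx; apply/matrixP => i j; rewrite !mxE /partial.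
under eq_fun => y do rewrite mxE.
rewrite -big_split -fct_sumE derive_sum; last first.
  by move=> k; apply/diff_derivable/differentiableM.
apply: eq_bigr => k _; rewrite !mxE.
rewrite deriveM; [|exact: diff_derivable..].
by rewrite addrC /GRing.scale /=; congr (_ + _); exact: mulrC.
Qed.

Lemma near_eq_mxpartial p q a (F H : 'rV[R]_n -> 'M[R]_(p, q)) x :
  (\near x, F x = H x) -> mxpartial a F x = mxpartial a H x.
Proof.
move=> FH; apply/matrixP => i j; rewrite !mxE; apply: near_eq_derive.
by apply: filterS FH => y ->.
Qed.

Lemma mxpartial_cst p q a (C : 'M[R]_(p, q)) x : mxpartial a (fun=> C) x = 0.
Proof. by apply/matrixP => i j; rewrite !mxE; exact: derive_cst. Qed.

End MatrixCalculus.

(** * Trilinear forms and integrable complex structures *)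

Section TrilinearForms.
Context {R : comNzRingType} {n : nat}.
Implicit Types (T : 'I_n -> 'I_n -> 'I_n -> R) (X Y Z : 'rV[R]_n) (J : 'M[R]_n).

(** Evaluating components on vectors turns a contraction with [J] into the substitution of [Y *m J]
    for an argument. *)
Definition sum3 T X Y Z : R :=
  \sum_a \sum_b \sum_c X 0 a * Y 0 b * Z 0 c * T a b c.

Lemma eq_sum3 T T' X Y Z : (forall a b c, T a b c = T' a b c) ->
  sum3 T X Y Z = sum3 T' X Y Z.
Proof.
move=> TT'.
apply: eq_bigr => a _; apply: eq_bigr => b _; apply: eq_bigr => c _.
by rewrite TT'.
Qed.

Lemma sum3D T T' X Y Z :
  sum3 (fun a b c => T a b c + T' a b c) X Y Z = sum3 T X Y Z + sum3 T' X Y Z.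
Proof.
rewrite -big_split; apply: eq_bigr => a _; rewrite -big_split.
apply: eq_bigr => b _; rewrite -big_split; apply: eq_bigr => c _.
by rewrite mulrDr.
Qed.

Lemma sum3N T X Y Z : sum3 (fun a b c => - T a b c) X Y Z = - sum3 T X Y Z.
Proof.
rewrite -sumrN; apply: eq_bigr => a _; rewrite -sumrN; apply: eq_bigr => b _.
by rewrite -sumrN; apply: eq_bigr => c _; rewrite mulrN.
Qed.

Lemma sum3_swap12 T X Y Z : sum3 T Y X Z = sum3 (fun a b c => T b a c) X Y Z.
Proof.
rewrite [LHS]exchange_big; apply: eq_bigr => a _; apply: eq_bigr => b _.
by apply: eq_bigr => c _; rewrite (mulrC (Y _ _)).
Qed.

Lemma sum3_swap23 T X Y Z : sum3 T X Z Y = sum3 (fun a b c => T a c b) X Y Z.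
Proof.
apply: eq_bigr => a _; rewrite exchange_big; apply: eq_bigr => b _.
by apply: eq_bigr => c _; rewrite -(mulrA (X _ _)) (mulrC (Z _ _)) mulrA.
Qed.

Lemma sum3_rot T X Y Z : sum3 (fun a b c => T b c a) X Y Z = sum3 T Y Z X.
Proof. by rewrite [RHS]sum3_swap23 sum3_swap12. Qed.

Lemma sum3_mulmx1 T X Y Z J :
  sum3 T (X *m J) Y Z = sum3 (fun a b c => \sum_d J a d * T d b c) X Y Z.
Proof.
rewrite /sum3.
transitivity (\sum_d \sum_a \sum_b \sum_c X 0 a * J a d * Y 0 b * Z 0 c * T d b c).
  apply: eq_bigr => d _; rewrite [RHS]exchange_big; apply: eq_bigr => b _ /=.
  rewrite [RHS]exchange_big; apply: eq_bigr => c _ /=.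
  by rewrite mxE -!mulrA mulr_suml; apply: eq_bigr => a _; rewrite !mulrA.
rewrite exchange_big; apply: eq_bigr => a _ /=.
rewrite exchange_big; apply: eq_bigr => b _ /=.
rewrite exchange_big; apply: eq_bigr => c _ /=.
by rewrite mulr_sumr; apply: eq_bigr => d _; ring.
Qed.

Lemma sum3_mulmx2 T X Y Z J :
  sum3 T X (Y *m J) Z = sum3 (fun a b c => \sum_d J b d * T a d c) X Y Z.
Proof. by rewrite sum3_swap12 sum3_mulmx1 sum3_swap12. Qed.

Lemma sum3_mulmx3 T X Y Z J :
  sum3 T X Y (Z *m J) = sum3 (fun a b c => \sum_d J c d * T a b d) X Y Z.
Proof. by rewrite sum3_swap23 sum3_mulmx2 sum3_swap23. Qed.

Lemma sum3_opp3 T X Y Z : sum3 T X Y (- Z) = - sum3 T X Y Z.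
Proof.
rewrite -sumrN; apply: eq_bigr => a _; rewrite -sumrN; apply: eq_bigr => b _.
by rewrite -sumrN; apply: eq_bigr => c _; rewrite mxE mulrN mulNr.
Qed.

Lemma sum3_delta T a b c :
  sum3 T (delta_mx 0 a) (delta_mx 0 b) (delta_mx 0 c) = T a b c.
Proof.
rewrite /sum3 (bigD1 a) //= [X in _ + X]big1 ?addr0; last first.
  move=> i /negPf ia; rewrite big1 // => j _; rewrite big1 // => k _.
  by rewrite mxE ia andbF !mul0r.
rewrite (bigD1 b) //= [X in _ + X]big1 ?addr0; last first.
  by move=> j /negPf jb; rewrite big1 // => k _; rewrite !mxE jb andbF mulr0 !mul0r.
rewrite (bigD1 c) //= [X in _ + X]big1 ?addr0; last first.
  by move=> k /negPf kc; rewrite !mxE kc andbF mulr0 !mul0r.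
by rewrite !mxE !eqxx !mul1r.
Qed.

(* [T a b c] stands for g((nabla_a J) d_b, d_c) and [C a b c] for the exterior
   derivative of the fundamental form. *)
Lemma cov_from_ext_der T J (C := fun a b c => T a b c + T b c a + T c a b) :
  J *m J = - 1%:M ->
  (forall a b c, T a b c = - T a c b) ->
  (forall a b c, \sum_d J b d * T a d c = \sum_d J c d * T a b d) ->
  (forall a b c, \sum_d J a d * T d b c - \sum_d J b d * T d a c =
     \sum_d J c d * T b a d - \sum_d J c d * T a b d) ->
  forall X Y Z, sum3 T X Y Z *+ 2 =
    sum3 C X Y Z - sum3 C X (Y *m J) (Z *m J).
Proof.
move=> JJ skew Jswitch nij X Y Z.
have VJJ U : U *m J *m J = - U by rewrite -mulmxA JJ mulmxN mulmx1.
have vskew U V W : sum3 T U V W = - sum3 T U W V.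
  by rewrite (sum3_swap23 T U V W) -sum3N; apply: eq_sum3 => a b c.
have vswitch U V W : sum3 T U (V *m J) W = sum3 T U V (W *m J).
  by rewrite sum3_mulmx2 sum3_mulmx3; apply: eq_sum3.
have vnij U V W : sum3 T (U *m J) V W - sum3 T (V *m J) U W =
    sum3 T V U (W *m J) - sum3 T U V (W *m J).
  rewrite !sum3_mulmx1 !sum3_mulmx3 (sum3_swap12 _ U V).
  rewrite (sum3_swap12 (fun a b c => \sum_d J c d * _) U V).
  by rewrite -!sum3N -!sum3D; apply: eq_sum3 => a b c.
have vC U V W : sum3 C U V W = sum3 T U V W + sum3 T V W U + sum3 T W U V.
  rewrite !sum3D (sum3_rot T U V W) (sum3_rot (fun a b c => T b c a) U V W).
  by rewrite (sum3_rot T V W U).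
(* In the difference of the two values of [C], the terms differentiated along [X] add up to twice
   the wanted one. The other four cancel by integrability at [Y], [Z] and [X *m J]. *)
have := vnij Y Z (X *m J).
rewrite !vC !VJJ !sum3_opp3 => h.
have h1 := vswitch X Y (Z *m J); rewrite VJJ sum3_opp3 in h1.
have h2 := vswitch (Y *m J) Z X.
have h3 := vskew (Z *m J) X (Y *m J).
have h4 := vswitch (Z *m J) Y X.
have h5 := vskew Z X Y.
rewrite h1 h2 h3 h4 h5.
by move: h => /(canRL (subrK _)) ->; ring.
Qed.
End TrilinearForms.

(** * Pointwise algebra of a Vaisman structure *)

(** Matrix products are first made opaque, so that [mxE] does not expand them into sums and only an
    identity in the additive group remains. *)
Ltac mx_abelian :=
  repeat match goal with |- context [@mulmx ?S ?m ?p ?q ?A ?B] =>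
    move: (@mulmx S m p q A B) => ? end;
  apply/matrixP => ? ?; rewrite !mxE; ring.

(** Meant for [v] = J T and for [w], [g] the rows of omega and of the metric at one index. All terms
    in [w] cancel and [v] annihilates [theta]; what survives is [- t] times the difference of the
    two sides. *)
Lemma contract_parallel (R : fieldType) n (t p q : R) (theta eta w g v : 'rV[R]_n) :
  t != 0 -> v *m theta^T = 0 -> v *m eta^T = (- t)%:M -> v *m g^T = (- q)%:M ->
  v *m (t *: (theta^T *m (- w) + w^T *m theta + eta^T *m g - g^T *m eta)
    - (t *: w - q *: theta + p *: eta)^T *m theta
    + theta^T *m (t *: w - q *: theta + p *: eta)) = 0 ->
  t *: g = q *: eta + p *: theta.
Proof.
move=> t0 vtheta veta vg; set M := (X in v *m X) => vM.
have ME : M = theta^T *m (p *: eta) + eta^T *m (t *: g - p *: theta)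
              - g^T *m (t *: eta).
  by apply/matrixP => i j; rewrite /M !mxE !big_ord1 !mxE; ring.
apply: (scalerI t0); apply/eqP; rewrite -subr_eq0 -oppr_eq0 -vM ME; apply/eqP.
rewrite mulmxBr !mulmxDr !mulmxA vtheta veta vg mul0mx add0r !mul_scalar_mx.
by apply/matrixP => i j; rewrite !mxE; ring.
Qed.

(* At a point: row b of [Gam a] holds the components of nabla_{d_a} d_b, [dJ a]
   and [dW a] are the a-th partial derivatives of J and of the fundamental form
   [W], and [B a] is nabla_a J. *)
Section CovariantDerivativeOfJ.
Context {R : realType} {n : nat}.
Variables (G J : 'M[R]_n) (theta : 'rV[R]_n) (Gam dJ dW : 'I_n -> 'M[R]_n).
Let B a := dJ a + J *m Gam a - Gam a *m J.
Let W := J *m G.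
Let eta := theta *m J^T.
Hypothesis Gsym : G^T = G.
Hypothesis JJ : J *m J = - 1%:M.
Hypothesis JGJ : J *m G *m J^T = G.
Hypothesis Gam_sym : forall a b c, Gam a b c = Gam b a c.
Hypothesis dJJ : forall a, dJ a *m J + J *m dJ a = 0.
Hypothesis nij0 : forall a b c, \sum_d (J a d * dJ d b c - J b d * dJ d a c
  + J d c * dJ b a d - J d c * dJ a b d) = 0.
Hypothesis dW_skew : forall a, (dW a)^T = - dW a.
Hypothesis dWE : forall a, dW a = B a *m G + Gam a *m W + W *m (Gam a)^T.
Hypothesis dW_lee : forall a b c,
  dW a b c + dW b c a + dW c a b = wedge12 theta W a b c.

(** * The covariant derivative of the fundamental form *)

Lemma fund_skew : W^T = - W.
Proof.
have : J *m (J *m G *m J^T) = W by rewrite JGJ.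
rewrite !mulmxA JJ !mulNmx mul1mx => /eqP; rewrite eqr_oppLR => /eqP <-.
by rewrite trmx_mul Gsym.
Qed.

(** This is the covariant derivative of J J = -1; the connection terms cancel. *)
Lemma cov_anticommute a : B a *m J = - (J *m B a).
Proof.
have /eqP := dJJ a; rewrite addr_eq0 => /eqP dE.
rewrite /B !mulmxBl !mulmxBr !mulmxDl !mulmxDr dE -(mulmxA _ J J) JJ !mulmxA JJ.
rewrite mulmxN mulNmx mulmx1 mul1mx.
mx_abelian.
Qed.

Lemma cov_fund_skew a : (B a *m G)^T = - (B a *m G).
Proof.
have -> : B a *m G = dW a - Gam a *m W - W *m (Gam a)^T
  by rewrite dWE; mx_abelian.
rewrite !linearB /= (trmx_mul (Gam a)) (trmx_mul W) fund_skew dW_skew trmxK mulmxN mulNmx.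
mx_abelian.
Qed.

(** For a torsion-free connection the Nijenhuis tensor may be computed with covariant instead of
    partial derivatives: by [Gam_sym] all Christoffel terms cancel. *)
Lemma cov_nijenhuis a b c :
  \sum_d J a d * B d b c - \sum_d J b d * B d a c
  + (B b *m J) a c - (B a *m J) b c = 0.
Proof.
have BE i k l : \sum_d J i d * B d k l =
    \sum_d J i d * dJ d k l + \sum_d J i d * (J *m Gam d) k l - (J *m Gam k *m J) i l.
  rewrite -(mulmxA J) [(J *m _) i l]mxE -big_split -sumrB /=.
  apply: eq_bigr => d _.
  have -> : (Gam k *m J) d l = (Gam d *m J) k l.
    by rewrite !mxE; apply: eq_bigr => e _; rewrite Gam_sym.
  by rewrite /B !mxE; ring.
have sym i k : \sum_d J i d * (J *m Gam d) k c = \sum_d J k d * (J *m Gam d) i c.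
  under eq_bigr do rewrite mxE mulr_sumr.
  under [RHS]eq_bigr do rewrite mxE mulr_sumr.
  rewrite exchange_big; apply: eq_bigr => d _; apply: eq_bigr => e _.
  by rewrite Gam_sym; ring.
have BJ i k : (B i *m J) k c =
    \sum_d J d c * dJ i k d + (J *m Gam i *m J) k c + Gam i k c.
  rewrite /B mulmxBl mulmxDl -(mulmxA _ J J) JJ mulmxN mulmx1 opprK.
  rewrite mxE [X in X + _]mxE; congr (_ + _ + _); rewrite mxE.
  by apply: eq_bigr => d _; exact: mulrC.
rewrite !BE !BJ (sym b a) (Gam_sym b a).
have := nij0 a b c; rewrite !(sumrB, big_split) /= => h.
rewrite -[RHS]h; ring.
Qed.

(** By [cov_from_ext_der] the left side is d omega at (d_a, d_b, d_c) minus d omega at (d_a, J d_b,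
    J d_c). After inserting d omega = theta /\ omega, the two terms with theta(d_a) cancel because
    omega is J-invariant. *)
Lemma cov_fund a : (B a *m G) *+ 2 =
  theta^T *m (col a W)^T + (row a W)^T *m theta
  + eta^T *m row a G - (row a G)^T *m eta.
Proof.
pose T a b c := (B a *m G) b c.
have BGJ i : B i *m G *m J^T = J *m (B i *m G).
  have GJ : G *m J^T = - W by rewrite -fund_skew /W trmx_mul Gsym.
  by rewrite -mulmxA GJ /W mulmxN !mulmxA cov_anticommute !mulNmx opprK.
have Tskew i j k : T i j k = - T i k j.
  by rewrite /T; move/matrixP: (cov_fund_skew i) => /(_ k j); rewrite !mxE.
have TJ i j k : \sum_d J k d * T i j d = (B i *m G *m J^T) j k.
  by rewrite mxE; apply: eq_bigr => d _; rewrite [J^T _ _]mxE mulrC.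
have Tswitch i j k : \sum_d J j d * T i d k = \sum_d J k d * T i j d.
  by rewrite TJ BGJ mxE.
(* This is [cov_nijenhuis] with its last index lowered by the metric. *)
have Tnij i j k : \sum_d J i d * T d j k - \sum_d J j d * T d i k =
    \sum_d J k d * T j i d - \sum_d J k d * T i j d.
  have JT l m : \sum_d J l d * T d m k = \sum_e (\sum_d J l d * B d m e) * G e k.
    under eq_bigr do rewrite /T mxE mulr_sumr.
    rewrite exchange_big; apply: eq_bigr => e _ /=.
    by rewrite mulr_suml; apply: eq_bigr => d _; rewrite mulrA.
  have TJE l m : \sum_d J k d * T l m d = - (\sum_e (B l *m J) m e * G e k).
    have JB : J *m B l = - (B l *m J) by rewrite cov_anticommute opprK.
    by rewrite TJ BGJ mulmxA JB mulNmx mxE; congr (- _); rewrite mxE.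
  rewrite !JT !TJE opprK [RHS]addrC -!sumrB; apply/eqP; rewrite -subr_eq0 -sumrB.
  apply/eqP; apply: big1 => e _.
  have := cov_nijenhuis i j e; move: (\sum_d _) (\sum_d _) => s1 s2 h.
  by rewrite -[RHS](mul0r (G e k)) -h; ring.
(* In the cyclic sum that forms d omega, the Christoffel terms cancel by symmetry, so partial
   derivatives may be replaced by covariant ones. *)
have TC i j k : T i j k + T j k i + T k i j = wedge12 theta W i j k.
  have Gw l m p : (Gam l *m W) m p = (Gam m *m W) l p.
    by rewrite !mxE; apply: eq_bigr => e _; rewrite Gam_sym.
  have wG l m p : (W *m (Gam l)^T) m p = - (Gam l *m W) p m.
    by rewrite -[W in LHS]opprK -fund_skew mulNmx -trmx_mul !mxE.
  have TE l m p : T l m p = dW l m p - (Gam l *m W) m p + (Gam l *m W) p m.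
    rewrite /T; have -> : B l *m G = dW l - Gam l *m W - W *m (Gam l)^T.
      by rewrite dWE; mx_abelian.
    by have := wG l m p; move: (W *m _) (_ *m W) => P Q PQ; rewrite !mxE PQ opprK.
  by rewrite !TE -dW_lee (Gw j i k) (Gw k i j) (Gw k j i); ring.
apply/matrixP => b c.
have JWJ : J *m W *m J^T = W by rewrite /W -(mulmxA J) JGJ.
have JW : J *m W = - G by rewrite /W mulmxA JJ mulNmx mul1mx.
have WJ : W *m J^T = G by [].
have := cov_from_ext_der JJ Tskew Tswitch Tnij (delta_mx 0 a) (delta_mx 0 b) (delta_mx 0 c).
rewrite sum3_mulmx2 sum3_mulmx3 !sum3_delta TC.
under [X in _ - X]eq_bigr => d _ do under eq_bigr => e _ do rewrite TC.
(* This computes theta /\ omega at (d_a, J d_b, J d_c). *)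
have -> : \sum_d J c d * (\sum_e J b e * wedge12 theta W a e d) =
   theta 0 a * (J *m W *m J^T) b c + eta 0 b * (J *m W) c a + eta 0 c * (W *m J^T) a b.
  transitivity (\sum_d \sum_e (theta 0 a * (J b e * W e d * J c d)
      + (theta 0 e * J b e) * (J c d * W d a)
      + (theta 0 d * J c d) * (W a e * J b e))).
    apply: eq_bigr => d _; rewrite mulr_sumr; apply: eq_bigr => e _.
    by rewrite /wedge12; ring.
  under eq_bigr do rewrite !big_split.
  rewrite !big_split; congr (_ + _ + _).
  - rewrite mxE mulr_sumr; apply: eq_bigr => d _.
    rewrite mxE mulr_suml mulr_sumr; apply: eq_bigr => e _.
    by rewrite [J^T _ _]mxE.
  - rewrite mxE (mxE _ _ c a) big_distrlr exchange_big.
    by apply: eq_bigr => e _; apply: eq_bigr => d _; rewrite [J^T _ _]mxE.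
  - rewrite mxE (mxE _ _ a b) big_distrlr.
    by apply: eq_bigr => d _; apply: eq_bigr => e _; rewrite ![J^T _ _]mxE.
rewrite JWJ JW WJ /wedge12 => h; rewrite mulmxnE -/(T a b c) h.
have Gca : G c a = G a c by rewrite -{1}Gsym mxE.
clearbody W eta; rewrite !mxE !big_ord1 !mxE Gca; ring.
Qed.

(** * Contraction with the Lee vector field *)

Hypothesis Gpos : forall v : 'rV[R]_n, v != 0 -> 0 < (v *m G *m v^T) 0 0.
(* [T] is the Lee vector field and [t] its squared length. *)
Let T := theta *m invmx G.
Let t := (theta *m invmx G *m theta^T) 0 0.

Let Gunit : G \in unitmx.
Proof.
rewrite unitmxE unitfE; apply/det0P => -[v v0 vG].
by have := Gpos v0; rewrite vG mul0mx mxE ltxx.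
Qed.

Let TG : T *m G = theta. Proof. exact: mulmxKV. Qed.

Let TW : T *m W = - eta.
Proof.
by rewrite -[W]opprK -fund_skew mulmxN trmx_mul Gsym mulmxA TG.
Qed.

(** Since [T *m W] is [- eta], the value eta(T) is - omega(T, T), which vanishes by skewness. *)
Let etaT : eta *m T^T = 0.
Proof.
have skew : (T *m W *m T^T)^T = - (T *m W *m T^T).
  by rewrite trmx_mul trmxK (trmx_mul T) fund_skew mulNmx mulmxN mulmxA.
apply/eqP; rewrite -oppr_eq0 -mulNmx -TW; apply/eqP/matrixP => i j.
move/matrixP: skew => /(_ i j); rewrite !ord1 !mxE => /eqP.
by rewrite -addr_eq0 -mulr2n mulrn_eq0 /= => /eqP.
Qed.

Let thetaT : theta *m T^T = t%:M.
Proof.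
by rewrite -[LHS]trmxK trmx_mul trmxK (mx11_scalar (T *m _)) tr_scalar_mx.
Qed.

(** As theta is dual to [T], the left side is [cov_fund] contracted with [T] in its last slot, where
    eta(T) = 0 and theta(T) = [t]. For parallel theta it is twice nabla_a eta. *)
Lemma cov_eta a : (theta *m (B a)^T) *+ 2 =
  t *: row a W - eta 0 a *: theta + theta 0 a *: eta.
Proof.
have -> : theta *m (B a)^T = (B a *m G *m T^T)^T.
  by rewrite -mulmxA trmx_mul [(G *m _)^T]trmx_mul trmxK Gsym TG.
rewrite -linearMn /= mulr2n -mulmxDl -mulr2n cov_fund !mulmxBl !mulmxDl.
rewrite -(mulmxA _ eta) etaT mulmx0 subr0 -(mulmxA _ theta) -(mulmxA _ _^T T^T).
rewrite -(mulmxA _ (row _ _)).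
have -> : (col a W)^T *m T^T = (- eta 0 a)%:M.
  rewrite -trmx_mul colE mulmxA -colE TW; apply/matrixP => i j.
  by rewrite !ord1 !mxE eqxx mulr1n.
rewrite thetaT; have -> : row a G *m T^T = (theta 0 a)%:M.
  rewrite -row_mul -[G]Gsym -trmx_mul TG; apply/matrixP => i j.
  by rewrite !ord1 !mxE eqxx mulr1n.
rewrite !mul_mx_scalar !linearD !linearZ /= !trmxK scaleNr.
by rewrite scalerN [- _ + _]addrC.
Qed.

(* Contracting the hypothesis with J T gives [t G = eta^T eta + theta^T theta],
   so that the fundamental form is proportional to [eta /\ theta]. *)
Lemma wedge_lee_eq0 :
  (forall a, t *: (B a *m G) - (theta *m (B a)^T)^T *m theta
             + theta^T *m (theta *m (B a)^T) = 0) ->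
  forall a b c, wedge12 theta W a b c = 0.
Proof.
move=> Q0.
(* If the squared length of [T] is zero, positivity of the metric forces [T], and with it theta, to
   vanish. *)
have [t0 | tn0] := eqVneq t 0.
  suff -> : theta = 0 by move=> a b c; rewrite /wedge12 !mxE !mul0r !addr0.
  have [T0 | /Gpos] := eqVneq T 0; first by rewrite -TG T0 mul0mx.
  by rewrite TG thetaT mxE t0 mul0rn ltxx.
pose V := T *m J.
have Vtheta : V *m theta^T = 0.
  by rewrite -[LHS]trmxK trmx_mul trmxK (trmx_mul T) mulmxA -/eta etaT trmx0.
have Veta : V *m eta^T = (- t)%:M.
  rewrite /eta trmx_mul trmxK mulmxA -(mulmxA T) JJ mulmxN mulmx1 mulNmx.
  by rewrite [T *m _]mx11_scalar -raddfN.
have VG : V *m G = - eta by rewrite -mulmxA TW.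
have E a : t *: row a G = eta 0 a *: eta + theta 0 a *: theta.
  (* The hypothesis is doubled so that [cov_fund] and [cov_eta] can be inserted without halves. *)
  have : V *m (t *: (B a *m G *+ 2) - ((theta *m (B a)^T) *+ 2)^T *m theta
      + theta^T *m ((theta *m (B a)^T) *+ 2)) = 0.
    rewrite -[RHS](mulmx0 _ V) -[in RHS](mul0rn _ 2) -(Q0 a); congr (_ *m _).
    move: (B a *m G) (theta *m _) => P F.
    by rewrite !mulr2n scalerDr [(F + F)^T]linearD /= mulmxDl mulmxDr; mx_abelian.
  have -> : B a *m G *+ 2 = theta^T *m (- row a W) + (row a W)^T *m theta
      + eta^T *m row a G - (row a G)^T *m eta.
    rewrite cov_fund; congr (_ *m _ + _ + _ - _).
    by rewrite -[W in RHS]opprK -fund_skew tr_col linearN opprK.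
  rewrite cov_eta; apply: contract_parallel => //.
  rewrite -[G]Gsym -tr_col trmxK colE mulmxA VG -colE.
  by apply/matrixP => i j; rewrite !ord1 !mxE eqxx mulr1n.
have {}E : t *: G = eta^T *m eta + theta^T *m theta.
  have rE a (u : 'rV[R]_n) : row a (u^T *m u) = u 0 a *: u.
    by rewrite row_mul -mul_scalar_mx; congr (_ *m _); apply/matrixP => i j;
      rewrite !ord1 !mxE eqxx mulr1n.
  by apply/row_matrixP => a; rewrite linearZ /= E linearD /= !rE.
have WE b c : t * W b c = eta 0 b * theta 0 c - theta 0 b * eta 0 c.
  have Jeta : J *m eta^T = - theta^T.
    by rewrite /eta trmx_mul trmxK mulmxA JJ mulNmx mul1mx.
  have : t *: W = eta^T *m theta - theta^T *m eta.
    have Jtheta : J *m theta^T = eta^T by rewrite /eta trmx_mul trmxK.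
    rewrite scalemxAr E mulmxDr (mulmxA J eta^T) Jeta (mulmxA J theta^T) Jtheta.
    by rewrite mulNmx addrC.
  by move=> /matrixP/(_ b c); rewrite mxE => ->; clearbody eta; rewrite !mxE !big_ord1 !mxE.
(* After multiplication by [t], omega becomes eta /\ theta, whose wedge product with theta is
   zero. *)
move=> a b c; apply: (mulfI tn0).
transitivity (theta 0 a * (t * W b c) + theta 0 b * (t * W c a) + theta 0 c * (t * W a b)).
  by rewrite /wedge12; ring.
by rewrite !WE; ring.
Qed.
End CovariantDerivativeOfJ.

(** * Flat Vaisman structures in a chart *)

Lemma smooth_mxdiff (R : realType) n p q (U : set 'rV[R]_n)
    (F : 'rV[R]_n -> 'M[R]_(p, q)) x : smooth_mx_on U F -> U x -> mxdiff F x.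
Proof. by move=> FU Ux i j; apply: (FU i j 1%N).1. Qed.

Lemma smooth_mxdiff_partial (R : realType) n p q (U : set 'rV[R]_n)
    (F : 'rV[R]_n -> 'M[R]_(p, q)) a x :
  smooth_mx_on U F -> U x -> mxdiff (mxpartial a F) x.
Proof.
move=> FU Ux i j; under eq_fun do rewrite mxE.
exact: ((FU i j 2).2 a).1.
Qed.

Lemma row_tr_mul (R : pzSemiRingType) n (u v : 'rV[R]_n) a :
  row a (u^T *m v) = u 0 a *: v.
Proof.
rewrite row_mul -mul_scalar_mx; congr (_ *m _); apply/matrixP => i j.
by rewrite !ord1 !mxE eqxx mulr1n.
Qed.

(* Compares the two mixed derivatives of [eta]: the terms in [eta] cancel by
   flatness, the remaining Christoffel terms by symmetry. *)
Lemma mixed_derivatives_cancel (R : numFieldType) n (P Qa Qb Ca Cb Dab Dba : 'M[R]_n)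
    (u : 'rV[R]_n) (a b : 'I_n) :
  row a Cb = row b Ca -> Dab - Dba + Cb *m Ca - Ca *m Cb = 0 ->
  2^-1 *: row a (Qb + Cb *m P + P *m Cb^T)
    + (2^-1 *: row b P + u *m Cb^T) *m Ca^T + u *m Dba^T =
  2^-1 *: row b (Qa + Ca *m P + P *m Ca^T)
    + (2^-1 *: row a P + u *m Ca^T) *m Cb^T + u *m Dab^T ->
  row a Qb = row b Qa.
Proof.
move=> rowC curv; have two0 : 2 != 0 :> R by rewrite pnatr_eq0.
have {}curv : (Dab + Cb *m Ca)^T = (Dba + Ca *m Cb)^T.
  by congr trmx; apply/eqP; rewrite -subr_eq0 opprD addrACA addrA; apply/eqP.
(* A common normal form for both sides: the second summands agree by [rowC], the third is symmetric
   in the two indices, and the last ones agree by [curv]. *)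
have K e f C C' Q D : 2^-1 *: row e (Q + C *m P + P *m C^T)
    + (2^-1 *: row f P + u *m C^T) *m C'^T + u *m D^T =
    2^-1 *: row e Q + 2^-1 *: (row e C *m P)
    + 2^-1 *: (row e P *m C^T + row f P *m C'^T) + u *m (D + C' *m C)^T.
  have -> : row e (Q + C *m P + P *m C^T) =
      row e Q + row e C *m P + row e P *m C^T by rewrite !linearD /= !row_mul.
  have -> : (D + C' *m C)^T = D^T + C^T *m C'^T by rewrite linearD /= trmx_mul.
  by rewrite mulmxDl mulmxDr -scalemxAl !mulmxA !scalerDr; mx_abelian.
rewrite !K rowC curv [row b P *m _ + _]addrC => /addIr/addIr/addIr.
exact: (scalerI (invr_neq0 two0)).
Qed.

(** Alternating the two transpositions three times is the cube of a 3-cycle, hence the identity, yet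
    it changes the sign three times. *)
Lemma sym12_skew23_eq0 (R : numDomainType) n (T : 'I_n -> 'M[R]_n) :
  (forall a b, row a (T b) = row b (T a)) -> (forall a, (T a)^T = - T a) ->
  forall a, T a = 0.
Proof.
move=> rowT skewT a; apply/matrixP => b c; rewrite mxE.
have s d e f : T d e f = T e d f.
  by have /rowP/(_ f) := rowT e d; rewrite !mxE.
have k d e f : T d e f = - T d f e.
  by have /matrixP/(_ f e) := skewT d; rewrite !mxE.
have : T a b c = - T a b c by rewrite {1}s k s k s k !opprK.
by move=> /eqP; rewrite -addr_eq0 -mulr2n mulrn_eq0 /= => /eqP.
Qed.

Section Chart.
Context {R : realType} {n : nat} (M : manifold R n).
Variables (Jf : endo_field M) (gf : bilinear_field M) (thf : one_form M).
Hypotheses (herm : Defs.hermitian Jf gf) (lee : lee_form Jf gf thf).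
Hypotheses (par : parallel gf thf) (gflat : flat gf).
Variable i : chart_index M.
Let U := img (atlas i).
Let G := gf i.
Let J := Jf i.
Let theta := thf i.
Let W := fund_form Jf gf i.
Let eta y := theta y *m (J y)^T.
Let Gam a y := \matrix_(b, c) christoffel G a b c y.
Let B a y := mxpartial a J y + J y *m Gam a y - Gam a y *m J y.
Let t y := (theta y *m invmx (G y) *m (theta y)^T) 0 0.
Let P y := t y *: W y - (eta y)^T *m theta y + (theta y)^T *m eta y.

(** * Differentiability of the components *)

Let riem : riemannian gf. Proof. by case: herm. Qed.

Let nearU x : U x -> nbhs x U.
Proof. by move=> Ux; apply: open_nbhs_nbhs; split=> //; exact: img_open. Qed.

Let Gdiff x : U x -> mxdiff G x.
Proof. exact/smooth_mxdiff/bilinear_smooth. Qed.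

Let Jdiff x : U x -> mxdiff J x.
Proof. exact/smooth_mxdiff/endo_smooth. Qed.

Let thdiff x : U x -> mxdiff theta x.
Proof. exact/smooth_mxdiff/form_smooth. Qed.

Let Wdiff x : U x -> mxdiff W x.
Proof. by move=> Ux; apply: mxdiffM; [exact: Jdiff|exact: Gdiff]. Qed.

Let etadiff x : U x -> mxdiff eta x.
Proof.
by move=> Ux; apply: mxdiffM; [exact: thdiff|exact/mxdiff_tr/Jdiff].
Qed.

Let Gunit x : U x -> G x \in unitmx.
Proof. exact: riemannian_unit. Qed.

Let invGdiff x : U x -> mxdiff (fun y => invmx (G y)) x.
Proof.
move=> Ux; apply: mxdiff_inv; last exact: Gdiff.
by apply: filterS (nearU Ux) => y; exact: Gunit.
Qed.

Let Gamdiff a x : U x -> mxdiff (Gam a) x.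
Proof.
move=> Ux b c; under eq_fun do rewrite mxE /christoffel.
have dG d k l : differentiable (partial d (fun y => G y k l)) x.
  have := @smooth_mxdiff_partial _ _ _ _ _ _ d _ (bilinear_smooth gf i) Ux k l.
  by under eq_fun do rewrite mxE.
apply: differentiableM; first exact: differentiable_cst.
apply: differentiable_sumf => d _; apply: differentiableM.
  exact: (invGdiff Ux).
by apply: differentiableB; [apply: differentiableD|].
Qed.

(** * First-order identities at a point of the chart *)

Let Gam_sym x a b c : U x -> Gam a x b c = Gam b x a c.
Proof. by move=> Ux; rewrite !mxE; exact: christoffel_torsion_free. Qed.

Let dG a x : U x -> mxpartial a G x = Gam a x *m G x + G x *m (Gam a x)^T.
Proof.
move=> Ux; apply/matrixP => b c; rewrite !mxE christoffel_metric //.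
congr (_ + _); apply: eq_bigr => d _; rewrite !mxE //.
exact: mulrC.
Qed.

Let dtheta a x : U x -> mxpartial a theta x = theta x *m (Gam a x)^T.
Proof.
move=> Ux; apply/matrixP => k b; rewrite ord1 !mxE; have /eqP := par Ux a b.
rewrite subr_eq0 => /eqP ->; apply: eq_bigr => c _.
by rewrite !mxE mulrC.
Qed.

(** By the product rule and metric compatibility, the covariant derivative of omega comes from [B] =
    nabla J alone. *)
Let dW a x : U x -> mxpartial a W x =
  B a x *m G x + Gam a x *m W x + W x *m (Gam a x)^T.
Proof.
move=> Ux; rewrite mxpartialM; [|exact: Jdiff|exact: Gdiff].
rewrite dG // /B /W /fund_form -/J -/G mulmxDr mulmxBl mulmxDl !mulmxA.
mx_abelian.
Qed.

Let JJ x : U x -> J x *m J x = - 1%:M.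
Proof. by move=> Ux; case: herm => cJ _ _; case: (cJ _ _ Ux). Qed.

Let JGJ x : U x -> J x *m G x *m (J x)^T = G x.
Proof. by move=> Ux; case: herm => _ _; exact. Qed.

Let Gsym x : U x -> (G x)^T = G x.
Proof. by move=> Ux; case: (riem Ux). Qed.

Let Wskew x : U x -> (W x)^T = - W x.
Proof. by move=> Ux; apply: fund_skew; [exact: Gsym|exact: JJ|exact: JGJ]. Qed.

Let dJJ a x : U x -> mxpartial a J x *m J x + J x *m mxpartial a J x = 0.
Proof.
move=> Ux; rewrite -mxpartialM; [|exact: Jdiff..].
rewrite -(mxpartial_cst a (- 1%:M : 'M[R]_n) x); apply: near_eq_mxpartial.
by apply: filterS (nearU Ux) => y; exact: JJ.
Qed.

Let dWskew a x : U x -> (mxpartial a W x)^T = - mxpartial a W x.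
Proof.
move=> Ux; rewrite -mxpartial_tr -mxpartialN; last exact: Wdiff.
by apply: near_eq_mxpartial; apply: filterS (nearU Ux) => y; exact: Wskew.
Qed.

Let nij x a b c : U x -> \sum_d (J x a d * mxpartial d J x b c
  - J x b d * mxpartial d J x a c + J x d c * mxpartial b J x a d
  - J x d c * mxpartial a J x b d) = 0.
Proof.
move=> Ux; case: herm => /(_ i x Ux)[_ /(_ a b c) N0] _ _.
rewrite -[RHS]N0 /nijenhuis; by apply: eq_bigr => d _; rewrite !mxE.
Qed.

Let dWlee x a b c : U x -> mxpartial a W x b c + mxpartial b W x c a
  + mxpartial c W x a b = wedge12 (theta x) (W x) a b c.
Proof. by move=> Ux; rewrite !mxE -(lee.2 _ _ Ux). Qed.

(** Together with [deta] this says that [P] is twice the covariant derivative of eta. *)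
Let deta2 x a : U x -> (theta x *m (B a x)^T) *+ 2 = row a (P x).
Proof.
move=> Ux; have := @cov_eta _ _ (G x) (J x) (theta x) (Gam^~ x)
  (fun a => mxpartial a J x) (fun a => mxpartial a W x).
move=> /(_ (Gsym Ux) (JJ Ux) (JGJ Ux)) ->.
- by rewrite /P linearD linearB /= [row a (t x *: _)]linearZ /= !row_tr_mul.
- by move=> *; exact: Gam_sym.
- by move=> *; exact: dJJ.
- by move=> *; exact: nij.
- by move=> *; exact: dWskew.
- by move=> *; exact: dW.
- by move=> *; exact: dWlee.
- by have [_] := riem Ux.
Qed.

(** Theta being parallel, only J contributes to nabla_a eta, which is the first summand; the second
    is the connection term. *)
Let deta a x : U x ->
  mxpartial a eta x = theta x *m (B a x)^T + eta x *m (Gam a x)^T.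
Proof.
move=> Ux; rewrite mxpartialM; [|exact: thdiff|exact/mxdiff_tr/Jdiff].
have -> : (B a x)^T = (mxpartial a J x)^T + (Gam a x)^T *m (J x)^T
    - (J x)^T *m (Gam a x)^T by rewrite /B linearB linearD /= !trmx_mul.
rewrite mxpartial_tr dtheta // mulmxBr mulmxDr !mulmxA.
mx_abelian.
Qed.

(** Obtained by differentiating G G^-1 = 1; it says that the inverse metric is parallel. *)
Let dinvG a x : U x -> mxpartial a (fun y => invmx (G y)) x =
  - (invmx (G x) *m Gam a x) - (Gam a x)^T *m invmx (G x).
Proof.
move=> Ux; have Gx := Gunit Ux.
have : mxpartial a (fun y => G y *m invmx (G y)) x = 0.
  rewrite -(mxpartial_cst a (1%:M : 'M[R]_n) x); apply: near_eq_mxpartial.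
  by apply: filterS (nearU Ux) => y Uy; rewrite mulmxV //; exact: Gunit.
rewrite mxpartialM; [|exact: Gdiff|exact: invGdiff].
move=> /(congr1 (mulmx (invmx (G x)))); rewrite mulmx0 mulmxDr mulKmx // dG //.
rewrite mulmxDl mulmxK // mulmxDr !mulmxA mulVmx // mul1mx addrC => /eqP.
by rewrite addr_eq0 opprD => /eqP.
Qed.

Let tdiff x : U x -> differentiable t x.
Proof.
move=> Ux; have : mxdiff (fun y => theta y *m invmx (G y) *m (theta y)^T) x.
  apply: mxdiffM; last exact/mxdiff_tr/thdiff.
  by apply: mxdiffM; [exact: thdiff|exact: invGdiff].
exact.
Qed.

(** The squared length of a parallel form is locally constant, because the inverse metric is
    parallel too. *)
Let dt a x : U x -> partial a t x = 0.
Proof.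
move=> Ux.
have : mxpartial a (fun y => theta y *m invmx (G y) *m (theta y)^T) x = 0.
  have d1 : mxdiff (fun y => theta y *m invmx (G y)) x.
    by apply: mxdiffM; [exact: thdiff|exact: invGdiff].
  rewrite mxpartialM //; last exact/mxdiff_tr/thdiff.
  rewrite mxpartialM; [|exact: thdiff|exact: invGdiff].
  rewrite mxpartial_tr dtheta // dinvG // trmx_mul trmxK !(mulmxDl, mulmxDr).
  rewrite !(mulmxN, mulNmx) !mulmxA.
  mx_abelian.
by move=> /matrixP/(_ 0 0); rewrite !mxE.
Qed.

Let Pdiff x : U x -> mxdiff P x.
Proof.
move=> Ux; apply: mxdiffD.
  apply: mxdiffD; first by apply: mxdiffZ; [exact: tdiff|exact: Wdiff].
  by apply: mxdiffN; apply: mxdiffM; [exact/mxdiff_tr/etadiff|exact: thdiff].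
by apply: mxdiffM; [exact/mxdiff_tr/thdiff|exact: etadiff].
Qed.

(* [Q a] is nabla_a P. *)
Let Q a y := t y *: (B a y *m G y) - (theta y *m (B a y)^T)^T *m theta y
  + (theta y)^T *m (theta y *m (B a y)^T).

(** With [t] locally constant and theta parallel, the covariant derivative falls only on omega and
    eta, which gives [Q a]. *)
Let dP a x : U x ->
  mxpartial a P x = Q a x + Gam a x *m P x + P x *m (Gam a x)^T.
Proof.
move=> Ux.
have dtW : mxdiff (fun y => t y *: W y) x.
  by apply: mxdiffZ; [exact: tdiff|exact: Wdiff].
have det : mxdiff (fun y => (eta y)^T *m theta y) x.
  by apply: mxdiffM; [exact/mxdiff_tr/etadiff|exact: thdiff].
have dte : mxdiff (fun y => (theta y)^T *m eta y) x.
  by apply: mxdiffM; [exact/mxdiff_tr/thdiff|exact: etadiff].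
rewrite mxpartialD //; last by apply: mxdiffD => //; exact: mxdiffN.
rewrite mxpartialD //; last exact: mxdiffN.
rewrite mxpartialN // mxpartialZ; [|exact: tdiff|exact: Wdiff].
rewrite dt // scale0r add0r.
rewrite mxpartialM; [|exact/mxdiff_tr/etadiff|exact: thdiff].
rewrite mxpartialM; [|exact/mxdiff_tr/thdiff|exact: etadiff].
rewrite !mxpartial_tr dW // deta // dtheta // /Q /P.
move: (theta x) (eta x) (W x) (B a x *m G x) (theta x *m (B a x)^T) (Gam a x).
move: (t x) => s th e w b f g.
rewrite !linearD /= !trmx_mul !trmxK !(mulmxDl, mulmxDr, mulNmx, mulmxN).
rewrite -!scalemxAl -!scalemxAr !mulmxA.
mx_abelian.
Qed.

(** * Second derivatives of eta and the Ricci identity *)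

(* [h a] is the a-th partial derivative of [eta], by [deta] and [deta2]; in this
   form it can be differentiated again. *)
Let h a y := 2^-1 *: row a (P y) + eta y *m (Gam a y)^T.

Let detah a x : U x -> mxpartial a eta x = h a x.
Proof.
move=> Ux; rewrite /h deta // -deta2 //; congr (_ + _).
by rewrite -[X in _ *: X]scaler_nat scalerA mulVf ?scale1r ?pnatr_eq0.
Qed.

Let rowPdiff a x : U x -> mxdiff (fun y => row a (P y)) x.
Proof.
move=> Ux k l; under eq_fun do rewrite mxE.
exact: Pdiff.
Qed.

Let halfdiff a x : U x -> mxdiff (fun y => 2^-1 *: row a (P y)) x.
Proof.
by move=> Ux; apply: mxdiffZ; [exact: differentiable_cst|exact: rowPdiff].
Qed.

Let etaGamdiff a x : U x -> mxdiff (fun y => eta y *m (Gam a y)^T) x.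
Proof.
by move=> Ux; apply: mxdiffM; [exact: etadiff|exact/mxdiff_tr/Gamdiff].
Qed.

Let hdiff a x : U x -> mxdiff (h a) x.
Proof. by move=> Ux; apply: mxdiffD; [exact: halfdiff|exact: etaGamdiff]. Qed.

Let dh a b x : U x -> mxpartial b (h a) x =
  2^-1 *: row a (mxpartial b P x) + h b x *m (Gam a x)^T
  + eta x *m (mxpartial b (Gam a) x)^T.
Proof.
move=> Ux; rewrite mxpartialD; [|exact: halfdiff|exact: etaGamdiff].
rewrite mxpartialZ; [|exact: differentiable_cst|exact: rowPdiff].
rewrite mxpartialM; [|exact: etadiff|exact/mxdiff_tr/Gamdiff].
rewrite mxpartial_tr detah // addrA /partial derive_cst scale0r add0r.
congr (_ *: _ + _ + _); apply/rowP => k; rewrite !mxE.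
by under eq_fun do rewrite mxE.
Qed.

(** Equality of mixed second derivatives of eta: [detah] holds on the whole chart image, so near [x]
    the functions [h a] and [h b] are first derivatives of eta, as [derive_symmetric] demands. *)
Let dh_sym a b x : U x -> mxpartial b (h a) x = mxpartial a (h b) x.
Proof.
move=> Ux; apply/matrixP => k c; rewrite [LHS]mxE [RHS]mxE.
have D e : \near x, is_derive x (delta_mx 0 e) (fun y => eta y k c) (h e x k c).
  apply: filterS (nearU Ux) => y Uy; rewrite -detah // mxE.
  by apply: is_derive_partial; exact: etadiff.
exact: (@derive_symmetric R _ (fun y => eta y k c) (fun y => h a y k c)
  (fun y => h b y k c) _ _ _ (D a) (D b) (hdiff a Ux k c) (hdiff b Ux k c)).
Qed.

(** The curvature in terms of connection matrices. Since row [c] of [Gam b] holds nabla_b d_c, the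
    composite nabla_a nabla_b yields the product [Gam b *m Gam a]. *)
Let curv a b x : U x -> mxpartial a (Gam b) x - mxpartial b (Gam a) x
  + Gam b x *m Gam a x - Gam a x *m Gam b x = 0.
Proof.
move=> Ux; apply/matrixP => c d; rewrite [RHS]mxE -(gflat Ux a b c d) /riemann.
rewrite sumrB !mxE addrA; congr (_ - _ + _ - _).
- by under eq_fun do rewrite mxE.
- by under eq_fun do rewrite mxE.
- by apply: eq_bigr => e _; rewrite !mxE.
- by apply: eq_bigr => e _; rewrite !mxE.
Qed.

(** Row [a] of [Q b] is twice nabla_b nabla_a eta, and by the Ricci identity second covariant
    derivatives commute when the curvature vanishes. *)
Let Q_sym a b x : U x -> row a (Q b x) = row b (Q a x).
Proof.
move=> Ux; have rowGam : row a (Gam b x) = row b (Gam a x).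
  by apply/rowP => c; rewrite 2![row _ _ _ _]mxE Gam_sym.
have := dh_sym a b Ux; rewrite (dh a b Ux) (dh b a Ux) (dP a Ux) (dP b Ux).
exact: (mixed_derivatives_cancel rowGam (curv a b Ux)).
Qed.

(** The derivative of omega is skew by [cov_fund_skew], and the other two terms are exchanged up to
    sign by transposition. *)
Let Q_skew a x : U x -> (Q a x)^T = - Q a x.
Proof.
move=> Ux; have := @cov_fund_skew _ _ (G x) (J x) (Gam^~ x)
  (fun a => mxpartial a J x) (fun a => mxpartial a W x).
move=> /(_ (Gsym Ux) (JJ Ux) (JGJ Ux) (fun a => dWskew a Ux)
  (fun a => dW a Ux) a).
rewrite -/(B a x) /Q; move: (B a x *m G x) (theta x *m (B a x)^T).
move: (theta x) (t x) => th s b f bskew.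
have -> : (s *: b - f^T *m th + th^T *m f)^T =
    s *: b^T - th^T *m f + f^T *m th.
  by rewrite linearD linearB linearZ /= !trmx_mul !trmxK.
rewrite bskew; mx_abelian.
Qed.

Let Q_eq0 a x : U x -> Q a x = 0.
Proof.
move=> Ux; apply: (sym12_skew23_eq0 (T := Q^~ x)) => [c d|c].
  exact: Q_sym.
exact: Q_skew.
Qed.

Lemma fund_form_closed_chart x a b c : U x -> ext_der2 W a b c x = 0.
Proof.
move=> Ux; rewrite (lee.2 _ _ Ux).
apply: (@wedge_lee_eq0 _ _ (G x) (J x) (theta x) (Gam^~ x)
  (fun a => mxpartial a J x) (fun a => mxpartial a W x)).
- exact: Gsym.
- exact: JJ.
- exact: JGJ.
- by move=> *; exact: Gam_sym.
- by move=> *; exact: dJJ.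
- by move=> *; exact: nij.
- by move=> *; exact: dWskew.
- by move=> *; exact: dW.
- by move=> *; exact: dWlee.
- by have [_] := riem Ux.
(* The remaining premise of [wedge_lee_eq0] is precisely nabla P = 0. *)
- by move=> d; exact: Q_eq0.
Qed.

End Chart.

Theorem theorem4p5 (R : realType) (n : nat) (M : manifold R n)
    (J : endo_field M) (g : bilinear_field M) :
  vaisman J g -> ~ kahler J g -> ~ flat g.
Proof.
move=> [herm [theta [lee par]]] nk gflat; apply: nk; split=> // i x Ux a b c.
exact: (fund_form_closed_chart herm lee par gflat).
Qed.
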